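(* Let $v_0\in\mathbb{R}$, $D>0$, and let $X$ be a random variable with $\mathbb{P}\{X\in\mathcal{L}(v_0,D)\}=1$, with $D$ the maximal span of $X$, with $\mathbb{E}X$ and $\mathbb{E}X^2$ finite, $\mu=\mathbb{E}X$ and $\sigma^2=\mathbb{E}X^2-(\mathbb{E}X)^2>0$. Let $X_1,X_2,\ldots$ be independent copies of $X$ and $S_n=X_1+\cdots+X_n$, $n\ge 1$. Let $\kappa_n\in\mathcal{L}(nv_0,D)$, $n=1,2,\ldots$, be a sequence of reals such that $$\lim_{n\to\infty}\frac{\kappa_n-n\mu}{\sqrt n}=\kappa$$ for some $\kappa\in\mathbb{R}$. Assume that $$\min\big(\mathbb{P}\{X=v_k\},\,\mathbb{P}\{X=v_{k+1}\}\big)>0\qquad\text{for some }k\in\mathbb{Z},$$ where $v_k=v_0+Dk$. Then there exists a constant $C$ (depending on the sequence $\{\kappa_n, n\ge 1\}$ and on the law of $X$, but not on $m,n$) such that for all integers $1\le m<n$, $$\sqrt{nm}\,\Big|\mathbb{P}\{S_n=\kappa_n,\ S_m=\kappa_m\}-\mathbb{P}\{S_n=\kappa_n\}\,\mathbb{P}\{S_m=\kappa_m\}\Big|\ \le\ C\left\{\frac{1}{\sqrt{\frac nm}-1}+\frac{n^{1/2}}{(n-m)^{3/2}}\right\}.$$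
   Context: For $v\in\mathbb{R}$ and $D>0$, $\mathcal{L}(v,D)=\{v+Dk: k\in\mathbb{Z}\}$ denotes the lattice; for the fixed $v_0$, write $v_k=v_0+Dk$, $k\in\mathbb{Z}$. $D$ is the maximal span of $X$ if $\mathbb{P}\{X\in\mathcal{L}(v_0,D)\}=1$ and there are no $v'\in\mathbb{R}$ and $D'>D$ with $\mathbb{P}\{X\in\mathcal{L}(v',D')\}=1$. *)

(* Defs.v *)
From HB Require Import structures.
From mathcomp Require Export all_boot all_order all_algebra finmap.
From mathcomp Require Export all_classical all_reals all_analysis.
Export Order.TTheory GRing.Theory Num.Theory.
Export numFieldNormedType.Exports.

Set Implicit Arguments.
Unset Strict Implicit.
Unset Printing Implicit Defensive.

Local Open Scope classical_set_scope.
Local Open Scope ring_scope.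

Definition lattice (R : realType) (v D : R) : set R :=
  [set x | exists k : int, x = v + D * k%:~R].

Definition maximal_span d (T : measurableType d) (R : realType)
    (P : probability T R) (X : {RV P >-> R}) (v0 D : R) : Prop :=
  P (X @^-1` lattice v0 D) = 1%E /\
  ~ (exists v' D' : R, D < D' /\ P (X @^-1` lattice v' D') = 1%E).

Definition mutually_independent d (T : measurableType d) (R : realType)
    (P : probability T R) (I : choiceType) (X : I -> {RV P >-> R}) : Prop :=
  forall (J : {fset I}) (A : I -> set R),
    (forall i, i \in J -> measurable (A i)) ->
    P (\bigcap_(i in [set` J]) (X i @^-1` A i)) =
    (\prod_(i <- J) P (X i @^-1` A i))%E.

(* The random variables X_1, X_2, ... of the mathematical text are
   Xs 0, Xs 1, ... *)
Definition independent_copies d (T : measurableType d) (R : realType)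
    (P : probability T R) (X : {RV P >-> R})
    d' (T' : measurableType d') (Q : probability T' R)
    (Xs : nat -> {RV Q >-> R}) : Prop :=
  mutually_independent Xs /\
  forall i (A : set R), measurable A ->
    distribution Q (Xs i) A = distribution P X A.

Definition partial_sum d (T : measurableType d) (R : realType)
    (P : probability T R) (Xs : nat -> {RV P >-> R}) (n : nat) (w : T) : R :=
  \sum_(i < n) Xs i w.

(* Main.v *)
Require Import Defs.
From mathcomp Require Import measurable_realfun ring lra zify.

(** Write X = v0 + D g almost surely, with g integer valued, and let c_N (x) be
the mass at x of the N-step walk with step law g.  By independence the two
probabilities at stake factor, and with r = n - m and kappa_n = n v0 + D j_n
the correlation is

  c_m (j_m) (c_r (j_n - j_m) - c_n (j_n)).

It is therefore enough to show that sqrt m c_m is bounded and that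
c_r (j_n - j_m) differs from c_n (j_n) by O(sqrt m / r): the product of
sqrt (n m) with the correlation is then O(sqrt (n m) / (n - m)), which is at
most a constant times (sqrt (n / m) - 1)^-1.

Both estimates come from one smoothing inequality (convolve_smoothing): if
|f| <= M, then the N-fold convolution of f with the law of g has increments at
most M sqrt (tau / (N + 1)).  It is an integration by parts.  Let a and a + 1
be two adjacent atoms and let the score of a step be the indicator of a + 1
divided by its mass, minus the indicator of a divided by its mass.  Then
E [score (g) f (x - g)] = f (x - (a + 1)) - f (x - a), so that, for the sum W
of the scores of N + 1 independent steps with sum S,
E [W f (x - S)] is N + 1 times an increment of the N-fold convolution of f; and
E |W| <= sqrt ((N + 1) tau), since the scores are centred with variance tau.

Applied to the indicator of the negative integers, whose increment is the unit
mass at 0, smoothing gives c_N = O(N^(-1/2)) (walk_mass_le).  Applied once more,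
to c_q with q about N / 2, it bounds the increments of c_N by O(1 / N)
(walk_mass_gradient), hence makes c_r Lipschitz with constant O(1 / r).  Now
c_n (j_n) is the mean of c_r (j_n - S_m) over the first m steps, whose sum S_m
is within O(sqrt m) of j_m in mean square because the deviation of kappa_m from
m mu is O(sqrt m).  The Lipschitz bound then gives the difference O(sqrt m / r)
(walk_mass_increment). *)

Set Implicit Arguments.
Unset Strict Implicit.
Unset Printing Implicit Defensive.

Local Open Scope classical_set_scope.
Local Open Scope ring_scope.

(** * Means under an integer law, and smoothing by convolution *)

Section IntegerLaw.
Context d (T : measurableType d) (R : realType) (P : probability T R).
Variable g : T -> int.
Hypothesis mg : forall k, measurable (g @^-1` [set k]).

Definition law_mean (f : int -> R) : R := \int[P]_w f (g w).
Definition law_integrable (f : int -> R) : Prop :=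
  P.-integrable setT (EFin \o (f \o g)).
Definition law_mass (k : int) : R := fine (P (g @^-1` [set k])).

(** Measurability of the fibres of g suffices, because there are countably many
of them. *)
Lemma measurable_fun_int (f : int -> R) : measurable_fun setT (f \o g).
Proof.
move=> _ Y _; rewrite setTI.
have -> : (f \o g) @^-1` Y =
    \bigcup_k (if asbool (Y (f k)) then g @^-1` [set k] else set0).
  apply/seteqP; split=> [w Yw|w [k _]].
    by exists (g w) => //=; case: asboolP.
  by case: asboolP => //= Yk gwk; rewrite gwk.
apply: countable_bigcupT_measurable => [|k]; last by case: ifP.
by [].
Qed.

Lemma law_integrable_bounded (f : int -> R) (M : R) :
  (forall k, `|f k| <= M) -> law_integrable f.
Proof.
move=> fM; apply: (@le_integrable _ _ _ _ _ _ _ (EFin \o cst M)) => //.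
- by apply/measurable_EFinP; exact: measurable_fun_int.
- by move=> w _ /=; rewrite lee_fin (le_trans (fM _)) ?ler_norm.
- exact: finite_measure_integrable_cst.
Qed.

Lemma law_integrableD (f h : int -> R) :
  law_integrable f -> law_integrable h -> law_integrable (fun k => f k + h k).
Proof. by move=> fi hi; have := integrableD measurableT fi hi; apply: eq_integrable. Qed.

Lemma law_integrableZ (c : R) (f : int -> R) :
  law_integrable f -> law_integrable (fun k => c * f k).
Proof. by move=> fi; have := integrableZl measurableT c fi; apply: eq_integrable. Qed.

Lemma law_integrable_cst (c : R) : law_integrable (fun=> c).
Proof. by apply: (@law_integrable_bounded _ `|c|). Qed.

Lemma law_meanD (f h : int -> R) : law_integrable f -> law_integrable h ->
  law_mean (fun k => f k + h k) = law_mean f + law_mean h.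
Proof. exact: RintegralD. Qed.

Lemma law_meanZ (c : R) (f : int -> R) : law_integrable f ->
  law_mean (fun k => c * f k) = c * law_mean f.
Proof. by move=> fi; rewrite /law_mean RintegralZl. Qed.

Lemma law_mean_cst (c : R) : law_mean (fun=> c) = c.
Proof.
rewrite /law_mean Rintegral_cst//.
by rewrite [X in fine X](_ : _ = 1%E) ?mulr1//; exact: probability_setT.
Qed.

Lemma ler_norm_law_mean (f h : int -> R) : law_integrable f ->
  law_integrable h -> (forall k, `|f k| <= h k) -> `|law_mean f| <= law_mean h.
Proof.
move=> fi hi fh; apply: le_trans (le_normr_Rintegral measurableT fi) _.
apply: le_Rintegral => //; first exact: (integrable_norm fi).
by move=> w _; exact: fh.
Qed.

Lemma law_mean_atom (a : int) (f : int -> R) :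
  law_mean (fun k => (k == a)%:R * f k) = law_mass a * f a.
Proof.
transitivity (law_mean (fun k => f a * (k == a)%:R)).
  congr law_mean; apply/funext => k.
  by case: eqP => [->|_]; rewrite ?mul0r ?mulr0// mulrC.
rewrite law_meanZ; last first.
  by apply: (@law_integrable_bounded _ 1) => k; case: eqP; rewrite ?normr0 ?normr1.
rewrite mulrC; congr (_ * _); rewrite /law_mean /Rintegral /law_mass.
congr fine; rewrite -[g @^-1` _]setIT -integral_indic//.
apply: eq_integral => w _; rewrite indicE; congr ((nat_of_bool _)%:R%:E).
by apply/idP/idP => [/eqP ?|/set_mem/= ->//]; exact/mem_set.
Qed.

Definition convolve (f : int -> R) (x : int) : R := law_mean (fun k => f (x - k)).

Lemma convolve_bounded (f : int -> R) (M : R) : (forall x, `|f x| <= M) ->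
  forall x, `|convolve f x| <= M.
Proof.
move=> fM x; rewrite -[leRHS]law_mean_cst; apply: ler_norm_law_mean => //.
  exact: (@law_integrable_bounded _ M).
exact: law_integrable_cst.
Qed.

Lemma iter_convolve_bounded N (f : int -> R) (M : R) : (forall x, `|f x| <= M) ->
  forall x, `|iter N convolve f x| <= M.
Proof. by move=> fM; elim: N => //= N IH; exact: convolve_bounded. Qed.

Lemma iter_convolve_shift N (f : int -> R) a :
  iter N convolve (fun x => f (x - a)) = fun x => iter N convolve f (x - a).
Proof.
elim: N => //= N ->; apply/funext => x; rewrite /convolve.
by congr law_mean; apply/funext => k; rewrite addrAC.
Qed.

Lemma iter_convolveB N (f h : int -> R) (M : R) :
  (forall x, `|f x| <= M) -> (forall x, `|h x| <= M) ->
  iter N convolve (fun x => f x - h x) =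
    fun x => iter N convolve f x - iter N convolve h x.
Proof.
move=> fM hM; elim: N => //= N ->; apply/funext => x; rewrite /convolve.
have bnd u : (forall x, `|u x| <= M) ->
    law_integrable (fun k => iter N convolve u (x - k)).
  by move=> uM; apply: (@law_integrable_bounded _ M) => k; exact: iter_convolve_bounded.
rewrite -[in RHS]mulN1r -law_meanZ; last exact: bnd.
rewrite -law_meanD; [|exact: bnd|exact/law_integrableZ/bnd].
by congr law_mean; apply/funext => k; rewrite mulN1r.
Qed.

Section Smoothing.
Variable a : int.
Hypotheses (pa : 0 < law_mass a) (pa1 : 0 < law_mass (a + 1)).

(** Discrete analogue of the score of a translation family: its pairing with f
differentiates f between the adjacent atoms. *)
Definition score (k : int) : R :=
  (k == a + 1)%:R / law_mass (a + 1) - (k == a)%:R / law_mass a.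
Definition score_var : R := (law_mass (a + 1))^-1 + (law_mass a)^-1.

Lemma score_bounded k : `|score k| <= score_var.
Proof.
have i0 : 0 < (law_mass a)^-1 by rewrite invr_gt0.
have i1 : 0 < (law_mass (a + 1))^-1 by rewrite invr_gt0.
rewrite /score /score_var ler_norml.
by case: (k == _); case: (k == _); rewrite /= ?mul1r ?mul0r; apply/andP; split; lra.
Qed.

Lemma law_mean_score (f : int -> R) (M : R) : (forall k, `|f k| <= M) ->
  law_mean (fun k => score k * f k) = f (a + 1) - f a.
Proof.
move=> fM.
have bnd b : law_integrable (fun k => (k == b)%:R * f k).
  apply: (@law_integrable_bounded _ M) => k.
  by case: eqP; rewrite ?mul1r ?mul0r ?normr0// (le_trans _ (fM k)).
transitivity (law_mean (fun k => (law_mass (a + 1))^-1 * ((k == a + 1)%:R * f k)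
                         + - (law_mass a)^-1 * ((k == a)%:R * f k))).
  by congr law_mean; apply/funext => k; rewrite /score; ring.
rewrite law_meanD; [|exact/law_integrableZ/bnd|exact/law_integrableZ/bnd].
rewrite !law_meanZ// !law_mean_atom.
by rewrite mulrA mulVf ?gt_eqF// mul1r mulNr mulrA mulVf ?gt_eqF// mul1r.
Qed.

Lemma law_mean_score0 : law_mean score = 0.
Proof.
transitivity (law_mean (fun k => score k * 1)).
  by congr law_mean; apply/funext => k; rewrite mulr1.
by rewrite (@law_mean_score _ 1) ?subrr// => k; rewrite normr1.
Qed.

Lemma law_mean_score2 : law_mean (fun k => score k * score k) = score_var.
Proof.
rewrite (@law_mean_score _ score_var); last exact: score_bounded.
have a1a : (a + 1 == a) = false by rewrite -subr_eq0 addrAC subrr.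
by rewrite /score /score_var !eqxx a1a (eq_sym a) a1a /=; ring.
Qed.

(** With W the sum of the scores of N independent steps and S the sum of the
steps, the quantity bounded is E [(y + W) f (x - S)].  The bound is
|t| <= (c + t^2 / c) / 2 at t = y + W, whose second moment is y^2 + N tau;
this quadratic form of Cauchy-Schwarz propagates through the induction one
step at a time, so that no joint law of (S, W) is needed. *)
Lemma score_weighted_bound N (f : int -> R) (M c : R) : 0 < c ->
  (forall x, `|f x| <= M) -> forall (x : int) (y : R),
  `|y * iter N convolve f x + N%:R *
     iter N.-1 convolve (fun x => f (x - (a + 1)) - f (x - a)) x|
  <= M * ((c + (y ^+ 2 + N%:R * score_var) / c) / 2).
Proof.
move=> c0 fM; set Bf := fun x => f (x - (a + 1)) - f (x - a).
have M0 : 0 <= M by apply: le_trans (fM 0).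
have BfM x : `|Bf x| <= M + M.
  by apply: (le_trans (ler_normB _ _)); apply: lerD.
elim: N => [|N IH] x y.
  rewrite !mul0r !addr0 normrM mulrC ler_pM//.
  rewrite -(ler_pM2r (_ : 0 < 2 * c)) ?mulr_gt0//.
  have -> : (c + y ^+ 2 / c) / 2 * (2 * c) = c ^+ 2 + y ^+ 2.
    by field; rewrite gt_eqF.
  rewrite -[y ^+ 2]real_normK ?num_real//.
  have := sqr_ge0 (c - `|y|); lra.
set u := iter N convolve f; set v := iter N.-1 convolve Bf.
have uM z : `|u z| <= M by exact: iter_convolve_bounded.
have vM z : `|v z| <= M + M by exact: iter_convolve_bounded.
have ui : law_integrable (fun k => u (x - k)).
  exact: (@law_integrable_bounded _ M).
have vi : law_integrable (fun k => v (x - k)).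
  exact: (@law_integrable_bounded _ (M + M)).
have wui : law_integrable (fun k => score k * u (x - k)).
  apply: (@law_integrable_bounded _ (score_var * M)) => k.
  by rewrite normrM ler_pM// score_bounded.
have si : law_integrable score.
  exact: (@law_integrable_bounded _ score_var score_bounded).
have s2i : law_integrable (fun k => score k * score k).
  apply: (@law_integrable_bounded _ (score_var * score_var)) => k.
  by rewrite normrM ler_pM// score_bounded.
(* Conditioning on one more step: the state (x, y) moves to
   (x - k, y + score k). *)
pose F k := y * u (x - k) + (score k * u (x - k) + N%:R * v (x - k)).
have Fi : law_integrable F.
  apply: law_integrableD; first exact: law_integrableZ.
  by apply: law_integrableD => //; exact: law_integrableZ.
have -> : y * iter N.+1 convolve f x + N.+1%:R * iter N.+1.-1 convolve Bf x
    = law_mean F.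
  rewrite /F law_meanD//; [|exact: law_integrableZ|]; last first.
    by apply: law_integrableD => //; exact: law_integrableZ.
  rewrite law_meanD//; last exact: law_integrableZ.
  rewrite !law_meanZ// (@law_mean_score _ M)//.
  rewrite -/(convolve u x) -/(convolve v x) /= -/u; congr (_ + _).
  have -> : N%:R * convolve v x = N%:R * iter N convolve Bf x.
    by rewrite /v; case: (N) => [|n]; rewrite ?mul0r.
  have -> : u (x - (a + 1)) - u (x - a) = iter N convolve Bf x.
    by rewrite (@iter_convolveB _ _ _ M)// !iter_convolve_shift.
  by rewrite -natr1 mulrDl mul1r addrC.
pose h k := M * ((c + (y ^+ 2 + N%:R * score_var) / c) / 2)
  + (M * y / c * score k + M / (2 * c) * (score k * score k)).
have hi : law_integrable h.
  apply: law_integrableD; first exact: law_integrable_cst.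
  by apply: law_integrableD; exact: law_integrableZ.
have -> : M * ((c + (y ^+ 2 + N.+1%:R * score_var) / c) / 2) = law_mean h.
  rewrite law_meanD ?law_mean_cst; [|exact: law_integrable_cst|]; last first.
    by apply: law_integrableD; exact: law_integrableZ.
  rewrite law_meanD; [|exact: law_integrableZ|exact: law_integrableZ].
  rewrite !law_meanZ// law_mean_score0 law_mean_score2 -natr1.
  by field; rewrite gt_eqF.
apply: ler_norm_law_mean => // k.
have := IH (x - k) (y + score k); rewrite -/u -/v.
rewrite (_ : _ + _ = F k); last by rewrite /F mulrDl addrA.
move=> /le_trans; apply.
rewrite le_eqVlt; apply/orP; left; apply/eqP; rewrite /h.
by field; rewrite gt_eqF.
Qed.

(** The weighted bound at y = 0, with the c that balances its two terms. *)
Lemma convolve_smoothing N (f : int -> R) (M : R) (x : int) : (forall x, `|f x| <= M) ->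
  `|iter N convolve f (x - 1) - iter N convolve f x|
    <= M * Num.sqrt (score_var / N.+1%:R).
Proof.
move=> fM.
have tau0 : 0 < score_var by rewrite addr_gt0 ?invr_gt0.
pose c : R := Num.sqrt (N.+1%:R * score_var).
have c0 : 0 < c by rewrite sqrtr_gt0 mulr_gt0.
have c2 : c ^+ 2 = N.+1%:R * score_var.
  by rewrite sqr_sqrtr// ltW// mulr_gt0.
have := score_weighted_bound N.+1 c0 fM (x + a) 0.
rewrite (@iter_convolveB _ _ _ M)// !iter_convolve_shift mul0r add0r expr0n/=.
rewrite (_ : x + a - (a + 1) = x - 1); last by ring.
rewrite addrK -c2.
have -> : (c + (0 + c ^+ 2) / c) / 2 = c by field; rewrite gt_eqF.
rewrite normrM normr_nat => H.
rewrite -(ler_pM2l (_ : 0 < N.+1%:R))//; apply: (le_trans H).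
rewrite mulrCA ler_wpM2l//; first exact: le_trans (fM 0).
rewrite le_eqVlt; apply/orP; left; apply/eqP; rewrite /c.
have -> : N.+1%:R * score_var = N.+1%:R ^+ 2 * (score_var / N.+1%:R).
  by rewrite expr2 -mulrA [X in _ = _ * X]mulrC divfK ?pnatr_eq0.
by rewrite sqrtrM ?sqr_ge0// sqrtr_sqr normr_nat.
Qed.

End Smoothing.
End IntegerLaw.

(** * Local bounds for an integer walk *)

Lemma lipschitz_int (R : realType) (f : int -> R) (L : R) :
  (forall x, `|f (x - 1) - f x| <= L) ->
  forall x y, `|f x - f y| <= L * `|(x - y)%:~R|.
Proof.
move=> fL.
have up (n : nat) x : `|f (x - n%:Z) - f x| <= L * n%:R.
  elim: n x => [|n IH] x; first by rewrite subr0 subrr normr0 mulr0.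
  rewrite -natr1 mulrDr mulr1 (_ : x - n.+1%:Z = x - n%:Z - 1); last by lia.
  rewrite -(subrKA (f (x - n%:Z))) addrC.
  by apply: (le_trans (ler_normD _ _)); rewrite lerD.
move=> x y; have [xy|/ltW yx] := leP y x.
  have -> : x - y = `|x - y|%N%:Z by lia.
  rewrite distrC -{1}(_ : x - `|x - y|%N%:Z = y); last by lia.
  by rewrite normr_nat.
have -> : x - y = - `|x - y|%N%:Z by lia.
rewrite -{1}(_ : y - `|x - y|%N%:Z = x); last by lia.
by rewrite mulrNz normrN normr_nat.
Qed.

Section IntegerWalk.
Context d (T : measurableType d) (R : realType) (P : probability T R).
Variable g : T -> int.
Hypothesis mg : forall k, measurable (g @^-1` [set k]).

Local Notation mean := (law_mean P g).
Local Notation conv := (convolve P g).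

Definition walk_mass (N : nat) : int -> R :=
  iter N conv (fun x => (x == 0)%:R).

Lemma dirac0_bounded (x : int) : `|(x == 0)%:R : R| <= 1.
Proof. by case: eqP; rewrite ?normr0 ?normr1. Qed.

Lemma walk_massD m r : walk_mass (m + r) = iter m conv (walk_mass r).
Proof. by rewrite /walk_mass iterD. Qed.

Lemma walk_mass_bounded N x : `|walk_mass N x| <= 1.
Proof. exact: iter_convolve_bounded dirac0_bounded _. Qed.

Lemma walk_mass_ge0 N x : 0 <= walk_mass N x.
Proof.
elim: N x => [|N IH] x /=; first by rewrite /walk_mass /= ler0n.
by apply: Rintegral_ge0 => w _; exact: IH.
Qed.

Section LocalBounds.
Variable a : int.
Hypotheses (pa : 0 < law_mass P g a) (pa1 : 0 < law_mass P g (a + 1)).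
Local Notation tau := (score_var P g a).

Lemma walk_mass_le N x : `|walk_mass N x| <= Num.sqrt (tau / N.+1%:R).
Proof.
(* The unit mass at 0 is the increment of the indicator of the negative
   integers. *)
pose h (y : int) : R := (y < 0)%R%:R.
have h1 y : `|h y| <= 1 by rewrite /h; case: ltP; rewrite ?normr0 ?normr1.
have dh : (fun y : int => (y == 0)%:R) = fun y => h (y - 1) - h y.
  apply/funext => y; rewrite /h; case: (ltgtP y 0) => y0.
  - by rewrite (_ : y - 1 < 0) ?subrr//; lia.
  - by rewrite (_ : (y - 1 < 0) = false) ?subrr//; lia.
  - by rewrite y0 subr0.
rewrite /walk_mass dh (@iter_convolveB _ _ _ _ _ mg _ _ _ 1)//.
rewrite iter_convolve_shift//.
by rewrite -[leRHS]mul1r; apply: convolve_smoothing.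
Qed.

(** Half of the steps make the mass small, the other half smooth it: the two
factors of order N^(-1/2) multiply. *)
Lemma walk_mass_gradient N x :
  `|walk_mass N (x - 1) - walk_mass N x| <= 2 * tau / N.+1%:R.
Proof.
have tau0 : 0 < tau by rewrite addr_gt0 ?invr_gt0.
pose q := N./2; pose q' := (N - q)%N.
have -> : N = (q + q')%N by rewrite /q' /q; lia.
rewrite walk_massD; apply: le_trans (convolve_smoothing mg pa pa1 q x
  (walk_mass_le q')) _.
have tau0' := ltW tau0.
rewrite -sqrtrM ?divr_ge0//.
have -> : 2 * tau / (q + q').+1%:R = Num.sqrt ((2 * tau / (q + q').+1%:R) ^+ 2).
  by rewrite sqrtr_sqr ger0_norm// divr_ge0// mulr_ge0.
apply: ler_wsqrtr.
have -> : tau / q'.+1%:R * (tau / q.+1%:R) = tau ^+ 2 * (q.+1%:R * q'.+1%:R)^-1.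
  by field; rewrite !nat1r !pnatr_eq0.
have -> : (2 * tau / (q + q').+1%:R) ^+ 2 = tau ^+ 2 * (4 / (q + q').+1%:R ^+ 2).
  by field; rewrite -natrD nat1r pnatr_eq0.
rewrite ler_wpM2l ?sqr_ge0// ler_pdivlMr ?exprn_gt0// mulrC ler_pdivrMr ?mulr_gt0//.
rewrite -natrX -!natrM ler_nat.
have [->|->] : q' = q \/ q' = q.+1 by rewrite /q' /q; lia.
  nia.
nia.
Qed.
End LocalBounds.

Section Concentration.
Hypotheses (i1 : law_integrable P g intr)
           (i2 : law_integrable P g (fun k => k%:~R ^+ 2)).

Definition law_center : R := mean intr.
Definition law_variance : R := mean (fun k => (k%:~R - law_center) ^+ 2).

Lemma law_variance_ge0 : 0 <= law_variance.
Proof. by apply: Rintegral_ge0 => w _; exact: sqr_ge0. Qed.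

(** The r-fold convolution of h at x is the mean of h (x - S); by the Lipschitz
bound its distance to h y is at most L E |x - y - S|, and
|t| <= (c + t^2 / c) / 2 reduces this first moment to the variance of S. *)
Lemma convolve_concentration (h : int -> R) (M L c : R) :
  0 <= L -> 0 < c ->
  (forall x, `|h x| <= M) ->
  (forall x y, `|h x - h y| <= L * `|(x - y)%:~R|) ->
  forall r (x y : int),
  `|iter r conv h x - h y| <=
    L * ((c + ((x%:~R - r%:R * law_center - y%:~R) ^+ 2
               + r%:R * law_variance) / c) / 2).
Proof.
move=> L0 c0 hM hL; elim=> [|r IH] x y.
  apply: le_trans (hL x y) _; rewrite ler_wpM2l//.
  rewrite !mul0r subr0 addr0 intrB; set z := _ - _.
  rewrite -(ler_pM2r (_ : 0 < 2 * c)) ?mulr_gt0//.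
  have -> : (c + z ^+ 2 / c) / 2 * (2 * c) = c ^+ 2 + z ^+ 2.
    by field; rewrite gt_eqF.
  rewrite -[z ^+ 2]real_normK ?num_real//.
  have := sqr_ge0 (c - `|z|); lra.
set z : R := x%:~R - r.+1%:R * law_center - y%:~R.
have ii : law_integrable P g (fun k => k%:~R - law_center).
  exact: law_integrableD (law_integrable_cst P mg _).
have ii2 : law_integrable P g (fun k => (k%:~R - law_center) ^+ 2).
  have := law_integrableD i2 (law_integrableD
    (law_integrableZ (- (2 * law_center)) i1)
    (law_integrable_cst P mg (law_center ^+ 2))).
  by congr law_integrable; apply/funext => k; ring.
have center0 : mean (fun k => k%:~R - law_center) = 0.
  by rewrite law_meanD//; [rewrite law_mean_cst// subrr|exact: law_integrable_cst].
pose F k := iter r conv h (x - k) - h y.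
have hi : law_integrable P g (fun k => iter r conv h (x - k)).
  apply: (law_integrable_bounded (M := M) P mg) => k.
  exact: iter_convolve_bounded.
have Fi : law_integrable P g F.
  exact: law_integrableD (law_integrable_cst P mg _).
have -> : iter r.+1 conv h x - h y = mean F.
  by rewrite law_meanD ?law_mean_cst//; exact: law_integrable_cst.
pose H k := L * ((c + (z ^+ 2 + r%:R * law_variance) / c) / 2)
  + (- (L * z / c) * (k%:~R - law_center)
     + L / (2 * c) * (k%:~R - law_center) ^+ 2).
have Hi : law_integrable P g H.
  apply: law_integrableD; first exact: law_integrable_cst.
  by apply: law_integrableD; exact: law_integrableZ.
have -> : L * ((c + (z ^+ 2 + r.+1%:R * law_variance) / c) / 2) = mean H.
  rewrite law_meanD ?law_mean_cst//; [|exact: law_integrable_cst|]; last first.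
    by apply: law_integrableD; exact: law_integrableZ.
  rewrite law_meanD; [|exact: law_integrableZ|exact: law_integrableZ].
  rewrite !law_meanZ// center0 -/law_variance -natr1.
  by field; rewrite gt_eqF.
apply: ler_norm_law_mean => // k.
apply: le_trans (IH (x - k) y) _.
rewrite le_eqVlt; apply/orP; left; apply/eqP; rewrite /H /z -natr1 intrB.
by field; rewrite gt_eqF.
Qed.

(** The first m steps reach y up to an error of order sqrt m, and c_r hardly
varies at that scale. *)
Lemma walk_mass_increment a (c : R) m r (x y : int) : 0 < c ->
  0 < law_mass P g a -> 0 < law_mass P g (a + 1) ->
  `|walk_mass (m + r) x - walk_mass r (x - y)| <=
    score_var P g a / r.+1%:R *
    (c + ((y%:~R - m%:R * law_center) ^+ 2 + m%:R * law_variance) / c).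
Proof.
move=> c0 pa pa1.
have tau0 : 0 < score_var P g a by rewrite addr_gt0 ?invr_gt0.
rewrite walk_massD.
apply: (le_trans (convolve_concentration _ c0 (walk_mass_bounded r)
  (lipschitz_int (walk_mass_gradient pa pa1 r)) m x (x - y))).
  by rewrite divr_ge0// mulr_ge0// ltW.
rewrite le_eqVlt; apply/orP; left; apply/eqP; rewrite intrB.
have -> : x%:~R - m%:R * law_center - (x%:~R - y%:~R) =
  y%:~R - m%:R * law_center by ring.
by field; rewrite nat1r pnatr_eq0 gt_eqF.
Qed.
End Concentration.
End IntegerWalk.

(** * From independent lattice variables to walk masses *)

(** A bijection from nat, which turns unions over the integers into the
sequential unions of sigma-additivity. *)
Definition int_enum (n : nat) : int := if odd n then Negz n./2 else Posz n./2.

Lemma int_enum_inj : injective int_enum.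
Proof.
move=> m n; rewrite /int_enum; case: ifP => om; case: ifP => on // [mn];
  by rewrite -(odd_double_half m) -(odd_double_half n) om on mn.
Qed.

Lemma int_enum_surj k : exists n, int_enum n = k.
Proof.
case: k => n; [exists n.*2|exists n.*2.+1]; rewrite /int_enum.
  by rewrite odd_double doubleK.
by rewrite /= odd_double/= uphalf_double.
Qed.

Lemma bigcup_int_enum T (U : int -> set T) :
  \bigcup_n U (int_enum n) = \bigcup_k U k.
Proof.
apply/seteqP; split=> [w [n _ Uw]|w [k _ Uw]]; first by exists (int_enum n).
by have [n nk] := int_enum_surj k; exists n => //; rewrite nk.
Qed.

Lemma trivIset_int_enum T (U : int -> set T) :
  trivIset setT U -> trivIset setT (U \o int_enum).
Proof. by move=> tU m n _ _ /tU H; exact/int_enum_inj/H. Qed.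

Lemma law_mean_series d (T : measurableType d) (R : realType)
    (P : probability T R) (g : T -> int) (f : int -> R) (M : R) :
  (forall k, measurable (g @^-1` [set k])) ->
  (forall k, 0 <= f k <= M) ->
  (law_mean P g f)%:E =
    (\sum_(n <oo) (f (int_enum n) * law_mass P g (int_enum n))%:E)%E.
Proof.
move=> mg fM.
have fi : law_integrable P g f.
  apply: (law_integrable_bounded (M := M) P mg) => k.
  by have /andP[f0 f1] := fM k; rewrite ger0_norm.
rewrite /law_mean /Rintegral fineK; last exact: integrable_fin_num fi.
pose F k := g @^-1` [set k].
have cF : [set: T] = \bigcup_n (F \o int_enum) n.
  rewrite bigcup_int_enum; apply/seteqP; split=> // w _.
  by exists (g w).
rewrite cF ge0_integral_bigcup/=.
- apply: eq_eseriesr => n _.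
  rewrite (@eq_integral _ _ _ _ _ (cst (f (int_enum n))%:E)); last first.
    by move=> w; rewrite inE => /= ->.
  rewrite integral_cst; last exact: mg.
  by rewrite EFinM /law_mass fineK// fin_num_measure//; exact: mg.
- by move=> n; exact: mg.
- rewrite -[X in measurable_fun X _]cF; apply/measurable_EFinP.
  exact: measurable_fun_int.
- by move=> w _; rewrite lee_fin; have /andP[] := fM (g w).
- apply: trivIset_int_enum => i j _ _ [w [/= <- <-]].
  by [].
Qed.

Lemma probability_setI_full d (T : measurableType d) (R : realType)
    (P : probability T R) (A B : set T) :
  measurable A -> measurable B -> P B = 1%E -> P (A `&` B) = P A.
Proof.
move=> mA mB B1; rewrite [in RHS](measureDI P mA mB).
rewrite [X in (X + _)%E](_ : _ = 0%E) ?add0e//.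
apply: (@subset_measure0 _ _ _ _ _ (~` B)); first exact: measurableD.
- exact: measurableC.
- by move=> w [].
- by have := probability_setC P mB; rewrite B1 subee.
Qed.

Section IndependentWalk.
Context d (T : measurableType d) (R : realType) (Q : probability T R).
Variable Xs : nat -> {RV Q >-> R}.
Hypothesis Xs_ind : mutually_independent Xs.

(** Events about the variables of index at least m, as a list of constraints so
that the constraint on the next variable can be peeled off. *)
Fixpoint cylinder (m : nat) (s : seq (set R)) : set T :=
  if s is B :: s' then Xs m @^-1` B `&` cylinder m.+1 s' else setT.

Definition all_measurable (s : seq (set R)) :=
  forall i, measurable (nth setT s i).

Lemma cylinderP m s w :
  cylinder m s w <-> forall i, nth setT s i (Xs (m + i)%N w).
Proof.
elim: s m => [|B s IH] m /=; first by split=> // _ i; rewrite nth_nil.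
split=> [[Bw /IH sw] [|i]|H]; first by rewrite addn0.
- by rewrite addnS -addSn; exact: sw.
- split; first by have := H 0%N; rewrite addn0.
  by apply/IH => i; have := H i.+1; rewrite addnS -addSn.
Qed.

Lemma measurable_cylinder m s : all_measurable s -> measurable (cylinder m s).
Proof.
elim: s m => //= B s IH m ms; apply: measurableI.
  by rewrite -[_ @^-1` _]setTI; apply: measurable_funP => //; exact: (ms 0%N).
by apply: IH => i; exact: (ms i.+1).
Qed.

Lemma cylinder_prod m s : all_measurable s ->
  Q (cylinder m s) =
    (\prod_(i <- iota m (size s)) Q (Xs i @^-1` nth setT s (i - m)%N))%E.
Proof.
move=> ms.
pose J := seq_fset tt (iota m (size s)).
have permJ : perm_eq J (iota m (size s)).
  by apply: perm_trans (seq_fset_perm _ _) _; rewrite undup_id ?iota_uniq.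
have memJ i : (i \in J) = (i \in iota m (size s)) by rewrite seq_fsetE.
have := Xs_ind (J := J) (A := fun i => nth setT s (i - m)%N) (fun i _ => ms _).
rewrite (perm_big _ permJ).
move=> <-; congr (Q _); apply/seteqP; split=> w.
  move=> /cylinderP H i /=; rewrite memJ mem_iota => /andP[mi _].
  by have := H (i - m)%N; rewrite subnKC.
move=> H; apply/cylinderP => i; have [is_|] := ltnP i (size s); last first.
  by move=> si; rewrite nth_default.
have := H (m + i)%N; rewrite /= memJ mem_iota leq_addr ltn_add2l addKn.
exact.
Qed.

Lemma cylinder_cons m B s : all_measurable (B :: s) ->
  Q (cylinder m (B :: s)) = (Q (Xs m @^-1` B) * Q (cylinder m.+1 s))%E.
Proof.
move=> ms; rewrite cylinder_prod// cylinder_prod; last by move=> i; exact: (ms i.+1).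
rewrite [size _]/= [iota _ _]/= big_cons subnn; congr (_ * _)%E.
rewrite !big_seq; apply: eq_bigr => i; rewrite mem_iota => /andP[mi _].
by rewrite (_ : (i - m)%N = (i - m.+1).+1)//; lia.
Qed.

(** The form in which mutual independence is carried along the walk: it holds
for the sure event and is inherited by the events of the walk, so the law at
two times needs no product measure. *)
Definition independent_of_future (m : nat) (E : set T) :=
  measurable E /\ forall s, all_measurable s ->
    Q (E `&` cylinder m s) = (Q E * Q (cylinder m s))%E.

Lemma setT_independent_of_future m : independent_of_future m setT.
Proof.
split=> // s _; rewrite setTI [X in (X * _)%E](_ : _ = 1%E) ?mul1e//.
exact: probability_setT.
Qed.

Context d' (T' : measurableType d') (P : probability T' R).
Variables (g : T' -> int) (v0 D : R).
Hypotheses (mg : forall k, measurable (g @^-1` [set k])) (D_gt0 : 0 < D).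
Hypothesis Xs_lattice : forall i, Q (Xs i @^-1` lattice v0 D) = 1%E.
Hypothesis Xs_mass : forall i k,
  Q (Xs i @^-1` [set v0 + D * k%:~R]) = (law_mass P g k)%:E.

Definition walk_event (E : set T) m r j : set T :=
  E `&` [set w | \sum_(i < r) Xs (m + i)%N w = r%:R * v0 + D * j%:~R].

Lemma measurable_walk_event E m r j :
  measurable E -> measurable (walk_event E m r j).
Proof.
move=> mE; apply: measurableI => //.
have mS : measurable_fun setT (fun w => \sum_(i < r) Xs (m + i)%N w).
  by apply: measurable_sum => i; exact: measurable_funP.
have := mS measurableT [set (r%:R * v0 + D * j%:~R)] (measurable_set1 _).
by rewrite setTI.
Qed.

Lemma measurable_lattice : measurable (lattice v0 D).
Proof.
have -> : lattice v0 D = \bigcup_k [set (v0 + D * k%:~R)%R].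
  by apply/seteqP; split=> [x [k ->]|x [k _ ->]]; exists k.
apply: countable_bigcupT_measurable => [|k]; first by [].
exact: measurable_set1.
Qed.

(** Each new step splits the event according to the atom reached by the new
variable.  That atom becomes one more constraint on the future of the r-step
event, and summing over the atoms is one more convolution. *)
Lemma walk_event_mass E m r j s : independent_of_future m E ->
  all_measurable s ->
  Q (walk_event E m r j `&` cylinder (m + r) s) =
    ((walk_mass P g r j)%:E * (Q E * Q (cylinder (m + r) s)))%E.
Proof.
move=> [mE iE]; elim: r j s => [|r IH] j s ms.
  rewrite addn0 /walk_event /walk_mass /=.
  have [->|j0] := eqVneq j 0.
    rewrite mul1e -iE//; congr (Q _); apply/seteqP; split => [w [[]]//|w [Ew sw]].
    by split => //; split => //=; rewrite big_ord0 mul0r mulr0 addr0.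
  rewrite mul0e [X in Q X](_ : _ = set0) ?measure0//.
  apply/seteqP; split=> // w [[_ /=]].
  rewrite big_ord0 mul0r add0r => /esym/eqP.
  by rewrite mulf_eq0 gt_eqF//= intr_eq0 (negbTE j0).
have mcyl := measurable_cylinder (m + r.+1) ms.
(* Restrict to the full event that the new variable is on the lattice. *)
rewrite -(@probability_setI_full _ _ _ _ _ (Xs (m + r)%N @^-1` lattice v0 D));
  last exact: Xs_lattice; first last.
- rewrite -[_ @^-1` _]setTI; apply: measurable_funP => //.
  exact: measurable_lattice.
- by apply: measurableI => //; exact: measurable_walk_event.
pose U k := walk_event E m r (j - k) `&`
  cylinder (m + r) ([set v0 + D * k%:~R] :: s).
have ms' k : all_measurable ([set v0 + D * k%:~R] :: s).
  by case=> [|i] /=; [exact: measurable_set1|exact: ms].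
rewrite [X in Q X](_ : _ = \bigcup_k U k); last first.
  apply/seteqP; split=> w.
    move=> [[[Ew /= Sw] sw] [k Xk]]; exists k => //; split; last first.
      by split=> //; rewrite -addnS.
    split=> //=; apply: (addIr (Xs (m + r)%N w)).
    rewrite -(big_ord_recr r (fun i => Xs (m + i)%N w)) /= Sw Xk -natr1 intrB.
    by ring.
  move=> [k _ [[Ew /= Sw] [/= Xk]]]; rewrite -addnS => sw.
  split; last by exists k.
  by split=> //; split=> //=; rewrite big_ord_recr/= Sw Xk -natr1 intrB; ring.
have mU k : measurable (U k).
  apply: measurableI; first exact: measurable_walk_event.
  exact: measurable_cylinder.
rewrite -bigcup_int_enum measure_semi_bigcup//; last 2 first.
- apply: trivIset_int_enum => k l _ _ [w [[_ [/= Xk _]] [_ [/= Xl _]]]].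
  move: Xk; rewrite Xl => /addrI/(mulfI (lt0r_neq0 D_gt0))/eqP.
  by rewrite eqr_int => /eqP.
- exact: bigcupT_measurable.
pose K := (Q E * Q (cylinder (m + r.+1) s))%E.
have Kfin : K = (fine K)%:E by rewrite fineK// fin_numM// fin_num_measure.
rewrite -/K Kfin.
transitivity (\sum_(n <oo) ((fine K)%:E *
   (walk_mass P g r (j - int_enum n) * law_mass P g (int_enum n))%:E))%E.
  apply: eq_eseriesr => n _; apply: etrans (IH _ _ (ms' _)) _.
  rewrite cylinder_cons// Xs_mass -Kfin /K.
  by rewrite EFinM addnS [RHS]muleC -!muleA; congr (_ * _)%E; rewrite muleCA.
rewrite nneseriesZl; last first.
  by move=> n _; rewrite lee_fin mulr_ge0// ?walk_mass_ge0// fine_ge0.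
rewrite muleC; congr (_ * _)%E.
rewrite -(@law_mean_series _ _ _ P g (fun k => walk_mass P g r (j - k)) 1)//.
move=> k; rewrite walk_mass_ge0/=.
by apply: le_trans (ler_norm _) _; exact: walk_mass_bounded.
Qed.

Lemma walk_event_independent E m r j : independent_of_future m E ->
  independent_of_future (m + r) (walk_event E m r j) /\
  Q (walk_event E m r j) = ((walk_mass P g r j)%:E * Q E)%E.
Proof.
move=> iE.
have QW : Q (walk_event E m r j) = ((walk_mass P g r j)%:E * Q E)%E.
  have m0 : all_measurable [::] by move=> i; rewrite nth_nil.
  have := walk_event_mass r j iE m0; rewrite /= setIT => ->.
  rewrite [X in (_ * (_ * X))%E](_ : _ = 1%E) ?mule1//; exact: probability_setT.
split=> //; split; first by apply: measurable_walk_event; case: iE.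
by move=> s ms; rewrite walk_event_mass// QW muleA.
Qed.

(** The walk restarted at time m from the event that its first m steps add up
to j. *)
Lemma two_time_mass m r j k :
  Q [set w | partial_sum Xs (m + r) w = (m + r)%:R * v0 + D * k%:~R /\
             partial_sum Xs m w = m%:R * v0 + D * j%:~R] =
  (walk_mass P g r (k - j) * walk_mass P g m j)%:E.
Proof.
have [iE QE] := walk_event_independent m j (setT_independent_of_future 0).
have [_] := walk_event_independent r (k - j) iE.
rewrite QE add0n [X in ((walk_mass _ _ m j)%:E * X)%E](_ : _ = 1%E); last first.
  exact: probability_setT.
rewrite mule1 -EFinM => <-; congr (Q _).
have S_split w : partial_sum Xs (m + r) w =
    partial_sum Xs m w + \sum_(i < r) Xs (m + i)%N w.
  by rewrite /partial_sum big_split_ord.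
apply/seteqP; split=> w /=; rewrite S_split.
  move=> [Sn Sm]; split; first by split.
  by move: Sn; rewrite Sm => /= /(canRL (addKr _)) ->; rewrite natrD intrB; ring.
move=> [[_ /= Sm] /= ->]; rewrite /partial_sum Sm natrD intrB; split=> //.
by ring.
Qed.

Lemma one_time_mass m j :
  Q [set w | partial_sum Xs m w = m%:R * v0 + D * j%:~R] =
  (walk_mass P g m j)%:E.
Proof.
have [_] := walk_event_independent m j (setT_independent_of_future 0).
rewrite [X in (_ * X)%E](_ : _ = 1%E); last exact: probability_setT.
by rewrite mule1 => <-; congr (Q _); rewrite /walk_event setTI.
Qed.
End IndependentWalk.

(** * The integer index of a lattice variable *)

Section LatticeIndex.
Context d (T : measurableType d) (R : realType) (P : probability T R).
Variables (X : {RV P >-> R}) (v0 D : R).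
Hypothesis D_gt0 : 0 < D.

(** The floor defines a measurable index on the whole space, while
X = v0 + D * lattice_index holds only on the event that X is in the lattice. *)
Definition lattice_index (w : T) : int := Num.floor ((X w - v0) / D).

Lemma measurable_lattice_index k : measurable (lattice_index @^-1` [set k]).
Proof.
have -> : lattice_index @^-1` [set k] =
    X @^-1` `[v0 + D * k%:~R, v0 + D * (k + 1)%:~R[%classic.
  have equiv w : (lattice_index w = k) <->
      (v0 + D * k%:~R <= X w < v0 + D * (k + 1)%:~R).
    rewrite -!lerBrDl -!ltrBlDl !(mulrC D) -ler_pdivlMr// -ltr_pdivrMr//.
    split=> [<-|]; first exact: floor_itv.
    exact: floor_def.
  by apply/seteqP; split=> w /=; rewrite in_itv/= => /equiv.
by rewrite -[_ @^-1` _]setTI; exact: measurable_funP.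
Qed.

Lemma lattice_index_atom k w :
  X w = v0 + D * k%:~R -> lattice_index w = k.
Proof.
by move=> Xw; rewrite /lattice_index Xw addrC addKr mulrC mulKf ?gt_eqF// intrKfloor.
Qed.

Lemma lattice_index_lattice w : lattice v0 D (X w) ->
  X w = v0 + D * (lattice_index w)%:~R.
Proof. by move=> [k Xw]; rewrite (lattice_index_atom Xw). Qed.

Lemma lattice_index_bound w :
  `|(lattice_index w)%:~R| <= D^-1 * `|X w| + (D^-1 * `|v0| + 1).
Proof.
set z := (X w - v0) / D.
have zle : `|z| <= D^-1 * `|X w| + D^-1 * `|v0|.
  have D'0 : 0 < D^-1 by rewrite invr_gt0.
  rewrite -mulrDr /z normrM (gtr0_norm D'0) mulrC ler_pM2l//.
  exact: ler_normB.
have /andP[] := floor_itv z; rewrite -/(lattice_index w) intrD => h1 h2.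
move: zle; rewrite addrA ler_norml ler_norml => /andP[h3 h4].
by apply/andP; split; lra.
Qed.

Lemma lattice_index_integrable :
  P.-integrable setT (EFin \o X) ->
  law_integrable P lattice_index intr.
Proof.
move=> iX; set b := D^-1 * `|v0| + 1.
apply: (@le_integrable _ _ _ _ _ measurableT _
  (EFin \o (fun w => D^-1 * `|X w| + b))).
- apply/measurable_EFinP.
  exact: (measurable_fun_int measurable_lattice_index).
- move=> w _ /=; rewrite lee_fin; apply: le_trans (lattice_index_bound w) _.
  exact: ler_norm.
- have := integrableD measurableT
    (integrableZl measurableT D^-1 (integrable_norm iX))
    (finite_measure_integrable_cst P b measurableT).
  exact: eq_integrable.
Qed.

Lemma lattice_index_integrable2 :
  P.-integrable setT (EFin \o (fun w => X w ^+ 2)) ->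
  law_integrable P lattice_index (fun k => k%:~R ^+ 2).
Proof.
move=> iX; set b := D^-1 * `|v0| + 1.
apply: (@le_integrable _ _ _ _ _ measurableT _
  (EFin \o (fun w => 2 * D^-1 ^+ 2 * X w ^+ 2 + 2 * b ^+ 2))).
- apply/measurable_EFinP.
  exact: (measurable_fun_int measurable_lattice_index).
- move=> w _ /=; rewrite lee_fin ger0_norm ?sqr_ge0//.
  apply: le_trans (ler_norm _).
  rewrite -real_normK ?num_real// -[X w ^+ 2]real_normK ?num_real//.
  have := lattice_index_bound w; rewrite -/b.
  set t := `|_|; set u := `|X w| => tu.
  have t0 : 0 <= t by exact: normr_ge0.
  have h : t ^+ 2 <= (D^-1 * u + b) ^+ 2 by rewrite lerXn2r ?nnegrE// (le_trans t0).
  apply: (le_trans h).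
  have := sqr_ge0 (D^-1 * u - b); nra.
- have := integrableD measurableT
    (integrableZl measurableT (2 * D^-1 ^+ 2) iX)
    (finite_measure_integrable_cst P (2 * b ^+ 2) measurableT).
  exact: eq_integrable.
Qed.

Hypothesis X_lattice : P (X @^-1` lattice v0 D) = 1%E.

Lemma measurable_preim_lattice : measurable (X @^-1` lattice v0 D).
Proof.
by rewrite -[_ @^-1` _]setTI; apply: measurable_funP => //; exact: measurable_lattice.
Qed.

Lemma lattice_index_mass k :
  P (X @^-1` [set v0 + D * k%:~R]) = (law_mass P lattice_index k)%:E.
Proof.
have mk := measurable_lattice_index k.
rewrite /law_mass fineK ?fin_num_measure//.
rewrite -[RHS](probability_setI_full mk measurable_preim_lattice X_lattice).
congr (P _); apply/seteqP; split=> w /=.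
  by move=> Xw; split; [exact: lattice_index_atom|exists k].
by move=> [<- /lattice_index_lattice].
Qed.

Lemma lattice_index_mean mu : P.-integrable setT (EFin \o X) ->
  ('E_P[X] = mu%:E)%E -> mu = v0 + D * law_center P lattice_index.
Proof.
move=> iX.
have mi := measurable_lattice_index.
have ii := lattice_index_integrable iX.
have -> : v0 + D * law_center P lattice_index =
    law_mean P lattice_index (fun k => v0 + D * k%:~R).
  rewrite law_meanD; [|exact: law_integrable_cst|exact: law_integrableZ].
  by rewrite law_mean_cst law_meanZ.
rewrite expectation_def => E_mu.
rewrite -[mu]/(fine mu%:E) -E_mu /law_mean /Rintegral; congr fine.
apply: ae_eq_integral => //.
- by apply/measurable_EFinP; exact: measurable_funP.
- by apply/measurable_EFinP; exact: (measurable_fun_int mi (fun k => v0 + D * k%:~R)).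
exists (~` (X @^-1` lattice v0 D)); split.
- exact/measurableC/measurable_preim_lattice.
- have := probability_setC P measurable_preim_lattice.
  by rewrite X_lattice subee.
- move=> w /= H L; apply: H => _; congr (_%:E); exact: lattice_index_lattice.
Qed.
End LatticeIndex.

(** * The correlation of two local events *)

(** With p = sqrt x and q = sqrt y this is p q / (q^2 - p^2) <= p / (q - p). *)
Lemma sqrt_ratio_gap (R : realType) (x y : R) : 0 < x -> x < y ->
  Num.sqrt (y * x) / (y - x) <= (Num.sqrt (y / x) - 1)^-1.
Proof.
move=> x0 xy; have y0 : 0 < y by exact: lt_trans xy.
have x0' := ltW x0; have y0' := ltW y0.
rewrite !sqrtrM// sqrtrV//.
have [p0 pq] : 0 < Num.sqrt x /\ Num.sqrt x < Num.sqrt y.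
  by rewrite sqrtr_gt0 ltr_sqrt.
rewrite (_ : y - x = Num.sqrt y ^+ 2 - Num.sqrt x ^+ 2); last first.
  by rewrite !sqr_sqrtr.
move: p0 pq; set p := Num.sqrt x; set q := Num.sqrt y => p0 pq.
have d0 : 0 < q ^+ 2 - p ^+ 2 by nra.
have -> : (q / p - 1)^-1 = p / (q - p).
  by rewrite -[RHS]invf_div mulrBl divff ?gt_eqF.
rewrite ler_pdivrMr// mulrAC ler_pdivlMr ?subr_gt0//; nra.
Qed.

Lemma seq_sqrt_bounded (R : realType) (u : nat -> R) (l : R) :
  (fun n => u n / Num.sqrt n%:R) @ \oo --> l ->
  exists2 K, 0 <= K & forall n, (0 < n)%N -> `|u n| <= K * Num.sqrt n%:R.
Proof.
move=> /cvgP/cvg_seq_bounded/pinfty_ex_gt0[K /ltW K0 HK].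
exists K => // n n0; have s0 : 0 < Num.sqrt (n%:R : R) by rewrite sqrtr_gt0 ltr0n.
have : `|u n / Num.sqrt n%:R| <= K by exact: (HK n I).
rewrite normrM normfV (gtr0_norm s0).
by rewrite ler_pdivrMr.
Qed.

Theorem theorem1p1 (R : realType) (d : measure_display) (T : measurableType d)
  (P : probability T R) (X : {RV P >-> R}) (v0 D mu sigma2 : R)
  (D_gt0 : 0 < D)
  (X_lattice : P (X @^-1` lattice v0 D) = 1%E)
  (D_max : maximal_span X v0 D)
  (X_int : P.-integrable setT (EFin \o X))
  (X2_int : P.-integrable setT (EFin \o (fun w => X w ^+ 2)))
  (mu_def : ('E_P[X] = mu%:E)%E)
  (sigma2_def : ('E_P[fun w => (X w ^+ 2)%R] - 'E_P[X] ^+ 2 = sigma2%:E)%E)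
  (sigma2_gt0 : 0 < sigma2)
  (kappa_ : nat -> R) (kappa : R)
  (kappa_lattice : forall n : nat, (1 <= n)%N ->
     lattice (n%:R * v0) D (kappa_ n))
  (kappa_cvg :
     (fun n : nat => (kappa_ n - n%:R * mu) / Num.sqrt n%:R) @ \oo --> kappa)
  (X_adjacent : exists k : int,
     (0 < Order.min (P (X @^-1` [set (v0 + D * k%:~R)%R]))
                    (P (X @^-1` [set (v0 + D * (k + 1)%:~R)%R])))%E) :
  exists C : R,
    forall (d' : measure_display) (T' : measurableType d')
      (Q : probability T' R) (Xs : nat -> {RV Q >-> R}),
    independent_copies X Xs ->
    let S := partial_sum Xs in
    forall m n : nat, (1 <= m < n)%N ->
      Num.sqrt (n%:R * m%:R) *
        `| fine (Q [set w | S n w = kappa_ n /\ S m w = kappa_ m])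
           - fine (Q [set w | S n w = kappa_ n])
             * fine (Q [set w | S m w = kappa_ m]) |
      <= C * ((Num.sqrt (n%:R / m%:R) - 1)^-1
              + n%:R `^ (1 / 2) / (n%:R - m%:R) `^ (3 / 2)).
Proof.
pose g := lattice_index X v0 D.
have mg k : measurable (g @^-1` [set k]) by exact: measurable_lattice_index.
have i1 : law_integrable P g intr by exact: lattice_index_integrable.
have i2 : law_integrable P g (fun k => k%:~R ^+ 2).
  exact: lattice_index_integrable2.
have mass k := lattice_index_mass D_gt0 X_lattice k.
have mu_center := lattice_index_mean D_gt0 X_lattice X_int mu_def.
have [a [pa pa1]] : exists a, 0 < law_mass P g a /\ 0 < law_mass P g (a + 1).
  move: X_adjacent => [a]; rewrite lt_min !mass !lte_fin => /andP[? ?].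
  by exists a.
have [K K0 kappaK] := seq_sqrt_bounded kappa_cvg.
pose j n : int := Num.floor ((kappa_ n - n%:R * v0) / D).
have kappa_j n : (1 <= n)%N -> kappa_ n = n%:R * v0 + D * (j n)%:~R.
  move=> /kappa_lattice[k kn]; rewrite /j kn.
  by rewrite [_ + _ - _]addrC addKr [_ / D]mulrC mulKf ?gt_eqF// intrKfloor.
pose tau := score_var P g a.
have tau0 : 0 < tau by rewrite addr_gt0 ?invr_gt0.
pose center := law_center P g; pose s2 := law_variance P g.
have s20 : 0 <= s2 by exact: law_variance_ge0.
have jK n : (1 <= n)%N -> ((j n)%:~R - n%:R * center) ^+ 2 <= (K / D) ^+ 2 * n%:R.
  move=> n1; have := kappaK n n1; rewrite kappa_j// mu_center -/g -/center.
  have -> : n%:R * v0 + D * (j n)%:~R - n%:R * (v0 + D * center) =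
     D * ((j n)%:~R - n%:R * center) by ring.
  rewrite normrM (gtr0_norm D_gt0) -ler_pdivlMl// mulrA => H.
  have -> : (K / D) ^+ 2 * n%:R = (D^-1 * K * Num.sqrt n%:R) ^+ 2.
    by rewrite [in RHS]exprMn sqr_sqrtr// [K / D]mulrC.
  rewrite -real_normK ?num_real//.
  by rewrite lerXn2r// nnegrE ?mulr_ge0 ?sqrtr_ge0 ?invr_ge0 ?(ltW D_gt0).
pose A := 1 + (K / D) ^+ 2 + s2.
have A0 : 0 <= A by rewrite !addr_ge0 ?sqr_ge0.
exists (Num.sqrt tau * tau * A) => d' T' Q Xs [Xs_ind Xs_law] /= m n /andP[m1 mn].
have Xs_lattice i : Q (Xs i @^-1` lattice v0 D) = 1%E.
  by rewrite -X_lattice; apply: Xs_law; exact: measurable_lattice.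
have Xs_mass i k : Q (Xs i @^-1` [set v0 + D * k%:~R]) = (law_mass P g k)%:E.
  by rewrite -mass; apply: Xs_law; exact: measurable_set1.
have n1 : (1 <= n)%N by exact: leq_trans (ltnW mn).
rewrite !kappa_j//.
rewrite !(one_time_mass Xs_ind mg D_gt0 Xs_lattice Xs_mass).
pose r := (n - m)%N; have nE : n = (m + r)%N by rewrite subnKC// ltnW.
rewrite [in X in fine X - _]nE (two_time_mass Xs_ind mg D_gt0 Xs_lattice Xs_mass) -nE /=.
have m0 : 0 < m%:R :> R by rewrite ltr0n.
have n0 : 0 < n%:R :> R by rewrite ltr0n.
have rE : r%:R = n%:R - m%:R :> R by rewrite natrB// ltnW.
have r0 : 0 < r%:R :> R by rewrite ltr0n subn_gt0.
set cr := walk_mass _ _ r _; set cm := walk_mass _ _ m _; set cn := walk_mass _ _ n _.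
have cm0 : 0 <= cm by exact: walk_mass_ge0.
have cmle : Num.sqrt m%:R * cm <= Num.sqrt tau.
  have := walk_mass_le mg pa pa1 m (j m); rewrite ger0_norm// -/cm -/tau => H.
  apply: le_trans (ler_wpM2l (sqrtr_ge0 _) H) _.
  rewrite -sqrtrM// ler_wsqrtr// mulrCA ler_piMr ?(ltW tau0)//.
  by rewrite ler_pdivrMr ?ltr0n// mul1r ler_nat.
have diffle : `|cn - cr| <= tau / r%:R * (Num.sqrt m%:R * A).
  have s0 : 0 < Num.sqrt (m%:R : R) by rewrite sqrtr_gt0.
  have := walk_mass_increment mg i1 i2 m r (j n) (j m) s0 pa pa1.
  rewrite -nE -/cn -/cr -/tau -/center -/s2 => /le_trans; apply.
  have tau0' := ltW tau0; have s0' := ltW s0.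
  apply: ler_pM.
  - by rewrite divr_ge0.
  - by rewrite addr_ge0// divr_ge0// addr_ge0 ?sqr_ge0// mulr_ge0.
  - by rewrite ler_pM2l// lef_pV2 ?ler_nat// posrE ltr0n.
  rewrite /A -[1 + _ + _]addrA mulrDr mulr1 lerD2l ler_pdivrMr// mulrAC -expr2 sqr_sqrtr//.
  by rewrite mulrDr [m%:R * s2]mulrC lerD2r [leRHS]mulrC; exact: jK.
have -> : cr * cm - cn * cm = - (cm * (cn - cr)) by ring.
rewrite normrN normrM (ger0_norm cm0).
apply: (@le_trans _ _ (Num.sqrt tau * tau * A * (Num.sqrt (n%:R / m%:R) - 1)^-1)).
  (* The bound is by the first term of the right-hand side. *)
  have gap := sqrt_ratio_gap m0 (_ : m%:R < n%:R :> R).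
  apply: le_trans (ler_wpM2l _ (gap _)); rewrite ?ltr_nat// ?mulr_ge0 ?sqrtr_ge0 ?(ltW tau0)//.
  rewrite -rE sqrtrM//.
  have -> : Num.sqrt tau * tau * A * (Num.sqrt n%:R * Num.sqrt m%:R / r%:R) =
    Num.sqrt n%:R * (Num.sqrt tau * (tau / r%:R * (Num.sqrt m%:R * A))) by ring.
  rewrite -mulrA ler_wpM2l ?sqrtr_ge0// mulrA ler_pM ?mulr_ge0 ?sqrtr_ge0//.
rewrite ler_wpM2l ?mulr_ge0 ?sqrtr_ge0 ?(ltW tau0)//.
by rewrite lerDl divr_ge0// powR_ge0.
Qed.
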